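(* Let $s$ be a state, $V$ a move, and $s'=Vs$ the resulting state, with components $u_i'$ and real coordinates $x_i'$. Let $W_i'=\sigma_c(u_i')-\bar\zeta\,x_i'$ be the deviations of $s'$ computed at the old center $\bar\zeta$ of $s$, and $T'_{\mathrm{old}}=\sum_i|W_i'|^2$. Let $\bar\zeta'$ and $T'$ be the Rayleigh center and transverse energy of $s'$. Then $$T'=\min_{c\in\mathbb C}\sum_i\bigl|\sigma_c(u_i')-c\,x_i'\bigr|^2=T'_{\mathrm{old}}-|\Delta\bar\zeta|^2|\xi'|^2,\qquad \Delta\bar\zeta:=\bar\zeta'-\bar\zeta=\frac{\langle\xi',V\nu_\perp\rangle}{|\xi'|^2},$$ where $\langle\cdot,\cdot\rangle$ is the bilinear dot product. In particular $T'\le T'_{\mathrm{old}}$ always, and $\Delta\bar\zeta$ is a linear functional of the old transverse data $\nu_\perp$ alone.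
   Context: $K$ is a cubic number field of signature $(1,1)$, with real embedding $\sigma_r$ and complex embedding $\sigma_c$; $L\subset\mathcal O_K$ is an order. A state is an ordered triple $s=(u_1,u_2,u_3)$ of elements of $L$ forming a $\mathbb Q$-basis of $K$ with $x_i=\sigma_r(u_i)>0$. Put $\xi=(x_1,x_2,x_3)$ and $\nu=(\sigma_c(u_1),\sigma_c(u_2),\sigma_c(u_3))\in\mathbb C^3$. The Rayleigh center is $\bar\zeta=\langle\xi,\nu\rangle/|\xi|^2\in\mathbb C$ (bilinear dot product; the bar is part of the symbol, not a conjugation); the deviations are $w_i=\sigma_c(u_i)-\bar\zeta x_i$, $\nu_\perp=(w_1,w_2,w_3)$, and the transverse energy is $T=\sum_i|w_i|^2$. A move is a matrix $V\in\mathrm{GL}_3(\mathbb Z)$ acting by $u_i'=\sum_jV_{ij}u_j$, with all new real coordinates $x_i'=\sigma_r(u_i')$ positive; thus $\xi'=V\xi$ and $\nu'=V\nu$. Primed quantities are those of $s'$. *)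

(* Defs.v *)
From mathcomp Require Import all_boot all_order all_algebra all_field.
From mathcomp Require Import classical_sets reals.
From mathcomp Require Import complex.

Set Implicit Arguments.
Unset Strict Implicit.
Unset Printing Implicit Defensive.

Import Order.TTheory GRing.Theory Num.Theory.

Local Open Scope ring_scope.
Local Open Scope complex_scope.

Section NumberField.
Variables (R : realType) (K : fieldExtType rat).

Definition nonreal (t : {rmorphism K -> R[i]}) : Prop :=
  exists x, Im (t x) != 0.

(* Embeddings are compared pointwise; the [r2] counts conjugate pairs. *)
Definition has_signature (r1 r2 : nat) : Prop :=
  (exists f : 'I_r1 -> {rmorphism K -> R},
     (forall i j, f i =1 f j -> i = j) /\
     (forall s : {rmorphism K -> R}, exists i, s =1 f i)) /\
  (exists g : 'I_r2 -> {rmorphism K -> R[i]},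
     [/\ forall i, nonreal (g i),
         forall i j, (g i =1 g j \/ g i =1 (fun x => (g j x)^*)) -> i = j
       & forall t : {rmorphism K -> R[i]}, nonreal t ->
           exists i, t =1 g i \/ t =1 (fun x => (g i x)^*)]).

Definition is_order (L : {pred K}) : Prop :=
  [/\ subring_closed L,
      forall x, x \in L -> integralOver (intr : int -> K) x
    & exists2 b : (\dim {:K}).-tuple K, basis_of {:K} b
        & forall x, x \in L <->
            exists c : 'I_(\dim {:K}) -> int, x = \sum_i (tnth b i *~ c i)].

Definition is_state (sr : {rmorphism K -> R}) (L : {pred K}) (u : 'cV[K]_3) :
    Prop :=
  [/\ forall i, u i 0 \in L,
      basis_of {:K} [tuple u i 0 | i < 3]
    & forall i, 0 < sr (u i 0)].

Definition act (V : 'M[int]_3) (u : 'cV[K]_3) : 'cV[K]_3 :=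
  map_mx intr V *m u.

Definition is_move (sr : {rmorphism K -> R}) (V : 'M[int]_3) (u : 'cV[K]_3) :
    Prop :=
  V \in unitmx /\ forall i, 0 < sr (act V u i 0).

Lemma act_state (sr : {rmorphism K -> R}) (L : {pred K}) V u :
  is_order L -> is_state sr L u -> is_move sr V u -> is_state sr L (act V u).
Proof.
move=> [subL _ _] [uL ub _] [Vu Vpos]; split=> //.
  move=> i; rewrite mxE.
  have [L0 LB LM] : [/\ 0 \in L, {in L &, forall x y, x - y \in L}
                      & {in L &, forall x y, x * y \in L}].
    by case: subL => L1 LB LM; split=> //; rewrite -(subrr 1) LB.
  have LN x : x \in L -> - x \in L by move=> xL; rewrite -sub0r LB.
  have LD x y : x \in L -> y \in L -> x + y \in L.
    by move=> xL yL; rewrite -[y]opprK LB ?LN.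
  have L1 : 1 \in L by case: subL.
  have Ln n : (n%:R : K) \in L by elim: n => // n IH; rewrite mulrS LD.
  apply: (big_ind (fun x => x \in L)) => // j _; rewrite mxE LM //.
  by case: (V i j) => n; rewrite ?NegzE ?mulrNz ?LN // -pmulrn Ln.
have dim3 : \dim {:K} = 3 by have := size_basis ub.
rewrite basisEdim size_tuple dim3 leqnn andbT.
have /andP[/eqP span_u _] := ub; rewrite -span_u; apply/span_subvP => x.
case/tnthP=> i ->; rewrite tnth_mktuple.
have uE : u = map_mx intr (invmx V) *m act V u.
  by rewrite /act mulmxA -map_mxM mulVmx // map_mx1 mul1mx.
rewrite {1}uE mxE; apply: memv_suml => j _; rewrite mxE.
rewrite mulrzl -scaler_int memvZ // memv_span //.
by apply/tnthP; exists j; rewrite tnth_mktuple.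
Qed.

End NumberField.

Definition dot (F : comNzRingType) (n : nat) (a b : 'cV[F]_n) : F :=
  \sum_i a i 0 * b i 0.

Section Transverse.
Variables (R : realType) (n : nat).
Implicit Types (xi : 'cV[R]_n) (nu : 'cV[R[i]]_n).

Definition toC xi : 'cV[R[i]]_n := map_mx (real_complex R) xi.

Definition rayleigh_center xi nu : R[i] := dot (toC xi) nu / (dot xi xi)%:C.

Definition deviation xi nu (c : R[i]) : 'cV[R[i]]_n := nu - c *: toC xi.

Definition transverse xi nu : 'cV[R[i]]_n :=
  deviation xi nu (rayleigh_center xi nu).

(* [normc] is the modulus with values in [R]; the norm [`|_|] of [R[i]] takes
   its values in [R[i]]. *)
Definition energy nu : R := \sum_i ComplexField.Normc.normc (nu i 0) ^+ 2.

Definition transverse_energy xi nu : R := energy (transverse xi nu).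

Definition is_min_value (T : Type) (f : T -> R) (m : R) : Prop :=
  range f m /\ lbound (range f) m.

End Transverse.

(* Main.v *)
From HB Require Import structures.
Require Import Defs.
From mathcomp Require Import all_boot all_order all_algebra all_field.
From mathcomp Require Import classical_sets reals complex.
From mathcomp Require Import ring.
Import Order.TTheory GRing.Theory Num.Theory.
Local Open Scope ring_scope.
Local Open Scope complex_scope.

(** The real vector [xi'] and the complex vector [nu'] of the new state enter
    only through one least-squares problem: approximate [nu'] by a complex
    multiple [c *: xi'].  Its residual is the deviation at [c], its cost is the
    energy, and the Rayleigh center is the coefficient for which the residual
    is orthogonal to [xi'] under the bilinear product
    ([dot_deviation], [dot_transverse]).  As [xi'] is real, bilinear
    orthogonality to [xi'] is the same as Hermitian orthogonality, so the
    residual at any other [c] splits orthogonally and Pythagoras gives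
    [energy_deviation]: the cost at [c] is the cost at the center plus
    [|center - c|^2 |xi'|^2].  Minimality, the formula for [T'] and
    [T' <= T'old] all follow from this one identity, the last two with [c]
    the old center.

    The formula for the shift comes from [dot_deviation] at the old center:
    deviations at a fixed [c] are linear in the pair [(xi, nu)], and the
    embeddings carry the integral move [V] to its action on both [xi] and [nu]
    ([map_act]), so the new residual at the old center is [V] applied to the
    old transverse vector ([deviation_mulmx]).  The positivity of the real
    coordinates is what makes [|xi'|^2] invertible. *)

Lemma dotDr (F : comNzRingType) n (a b c : 'cV[F]_n) :
  dot a (b + c) = dot a b + dot a c.
Proof.
by rewrite /dot -big_split /=; apply: eq_bigr => i _; rewrite mxE mulrDr.
Qed.

Lemma dotZr (F : comNzRingType) n (a b : 'cV[F]_n) k :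
  dot a (k *: b) = k * dot a b.
Proof. by rewrite /dot mulr_sumr; apply: eq_bigr => i _; rewrite mxE mulrCA. Qed.

Lemma dot_toC (R : realType) n (xi : 'cV[R]_n) :
  dot (toC xi) (toC xi) = (dot xi xi)%:C.
Proof.
by rewrite /dot rmorph_sum; apply: eq_bigr => i _; rewrite !mxE rmorphM.
Qed.

Lemma dot_gt0 (R : realType) n (xi : 'cV[R]_n.+1) :
  (forall i, 0 < xi i 0) -> 0 < dot xi xi.
Proof.
move=> xi_gt0; rewrite /dot big_ord_recl ltr_pwDl ?mulr_gt0 //.
by apply: sumr_ge0 => i _; rewrite mulr_ge0 // ltW.
Qed.

(** The normal equation: pairing the residual with [xi] measures the distance
    of [c] from the center. *)
Lemma dot_deviation (R : realType) n (xi : 'cV[R]_n) (nu : 'cV[R[i]]_n) c :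
  dot xi xi != 0 ->
  dot (toC xi) (deviation xi nu c) = (rayleigh_center xi nu - c) * (dot xi xi)%:C.
Proof.
move=> xi_neq0.
have xiC_neq0 : (dot xi xi)%:C != 0 by rewrite (inj_eq (@complexI R)).
by rewrite /deviation dotDr -scaleNr dotZr dot_toC mulrBl mulNr divfK.
Qed.

Lemma dot_transverse (R : realType) n (xi : 'cV[R]_n) (nu : 'cV[R[i]]_n) :
  dot xi xi != 0 -> dot (toC xi) (transverse xi nu) = 0.
Proof. by move=> xi_neq0; rewrite dot_deviation // subrr mul0r. Qed.

Lemma sqr_normcE (R : rcfType) (z : R[i]) :
  ComplexField.Normc.normc z ^+ 2 = complex.Re z ^+ 2 + complex.Im z ^+ 2.
Proof. by case: z => a b; rewrite sqr_sqrtr // addr_ge0 ?sqr_ge0. Qed.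

(** The law of cosines in the complex plane.  The real factor [x] is kept next
    to [w] so that the cross term sums to a bilinear product. *)
Lemma sqr_normcD_mul_real (R : rcfType) (w d : R[i]) (x : R) :
  ComplexField.Normc.normc (w + d * x%:C) ^+ 2 =
    ComplexField.Normc.normc w ^+ 2
    + ComplexField.Normc.normc d ^+ 2 * (x * x)
    + 2 * (complex.Re d * complex.Re (x%:C * w)
           + complex.Im d * complex.Im (x%:C * w)).
Proof. by rewrite !sqr_normcE; case: w d => [a b] [e f] /=; ring. Qed.

(** Pythagoras.  Since the entries of [xi] are real, the cross terms are real
    linear combinations of the real and imaginary parts of the bilinear
    product of [xi] and [w], so they cancel when that product vanishes. *)
Lemma energyD_orthogonal (R : realType) n (xi : 'cV[R]_n) (w : 'cV[R[i]]_n)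
    (d : R[i]) :
  dot (toC xi) w = 0 ->
  energy (w + d *: toC xi) =
    energy w + ComplexField.Normc.normc d ^+ 2 * dot xi xi.
Proof.
move=> xi_w.
have xi_w_Re : \sum_i complex.Re ((xi i 0)%:C * w i 0) = 0.
  transitivity (complex.Re (dot (toC xi) w)); last by rewrite xi_w.
  by rewrite raddf_sum; apply: eq_bigr => i _; rewrite mxE.
have xi_w_Im : \sum_i complex.Im ((xi i 0)%:C * w i 0) = 0.
  transitivity (complex.Im (dot (toC xi) w)); last by rewrite xi_w.
  by rewrite raddf_sum; apply: eq_bigr => i _; rewrite mxE.
rewrite /energy; under eq_bigr => i _ do rewrite !mxE sqr_normcD_mul_real.
rewrite !big_split /= -!mulr_sumr big_split /= -!mulr_sumr.
by rewrite xi_w_Re xi_w_Im !(mulr0, addr0).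
Qed.

Lemma energy_deviation (R : realType) n (xi : 'cV[R]_n) (nu : 'cV[R[i]]_n) c :
  dot xi xi != 0 ->
  energy (deviation xi nu c) = transverse_energy xi nu
    + ComplexField.Normc.normc (rayleigh_center xi nu - c) ^+ 2 * dot xi xi.
Proof.
move=> xi_neq0; rewrite -energyD_orthogonal ?dot_transverse //.
by rewrite /transverse /deviation scalerBl addrA subrK.
Qed.

Lemma map_act (F : comNzRingType) (K : fieldExtType rat)
    (f : {rmorphism K -> F}) (V : 'M[int]_3) (u : 'cV[K]_3) :
  map_mx f (act V u) = map_mx intr V *m map_mx f u.
Proof.
rewrite /act map_mxM; congr (_ *m _).
by apply/matrixP => i j; rewrite !mxE rmorph_int.
Qed.

Lemma deviation_mulmx (R : realType) n (V : 'M[int]_n) (xi : 'cV[R]_n)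
    (nu : 'cV[R[i]]_n) c :
  deviation (map_mx intr V *m xi) (map_mx intr V *m nu) c =
    map_mx intr V *m deviation xi nu c.
Proof.
rewrite /deviation mulmxBr -scalemxAr; congr (_ - _ *: _).
rewrite /toC map_mxM; congr (_ *m _).
by apply/matrixP => i j; rewrite !mxE rmorph_int.
Qed.

(** [(dot a (A *m w)) / k] named as a function of [w], so that linearity can be
    registered on it; [R[i]^o] is the scalar field as a module over itself. *)
Definition dot_mulmx_div {F : fieldType} {n} (a : 'cV[F]_n) (A : 'M[F]_n) (k : F)
  (w : 'cV[F]_n) : F^o := dot a (A *m w) / k.

Fact dot_mulmx_div_is_linear (F : fieldType) n (a : 'cV[F]_n) (A : 'M[F]_n) k :
  linear (dot_mulmx_div a A k).
Proof.
move=> z v w; rewrite /dot_mulmx_div mulmxDr -scalemxAr dotDr dotZr mulrDl.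
by rewrite -mulrA.
Qed.

HB.instance Definition _ (F : fieldType) n (a : 'cV[F]_n) (A : 'M[F]_n) k :=
  GRing.isLinear.Build F 'cV[F]_n F^o _ (dot_mulmx_div a A k)
    (dot_mulmx_div_is_linear F n a A k).

Theorem proposition3p5 (R : realType) (K : fieldExtType rat)
    (hdim : \dim {:K} = 3%N) (hsig : has_signature R K 1 1)
    (sr : {rmorphism K -> R}) (sc : {rmorphism K -> R[i]}) (hsc : nonreal sc)
    (L : {pred K}) (hL : is_order L)
    (u : 'cV[K]_3) (hu : is_state sr L u)
    (V : 'M[int]_3) (hV : is_move sr V u) :
  let u' := act V u in
  let xi := map_mx sr u in
  let nu := map_mx sc u in
  let xi' := map_mx sr u' in
  let nu' := map_mx sc u' in
  let zeta := rayleigh_center xi nu in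
  let zeta' := rayleigh_center xi' nu' in
  let nu_perp := transverse xi nu in
  let T' := transverse_energy xi' nu' in
  let T'old := energy (deviation xi' nu' zeta) in
  let Delta := zeta' - zeta in
  let shift (w : 'cV[R[i]]_3) : R[i] :=
    dot (toC xi') (map_mx intr V *m w) / (dot xi' xi')%:C in
  [/\ is_min_value (fun c : R[i] => energy (deviation xi' nu' c)) T',
      T' = T'old - ComplexField.Normc.normc Delta ^+ 2 * dot xi' xi',
      Delta = shift nu_perp,
      T' <= T'old
    & exists ell : {linear 'cV[R[i]]_3 -> R[i]^o},
        (forall w, ell w = shift w) /\ Delta = ell nu_perp].
Proof.
move=> u' xi nu xi' nu' zeta zeta' nu_perp T' T'old Delta shift.
have xi'_gt0 : 0 < dot xi' xi'.
  by apply: dot_gt0 => i; rewrite mxE; case: hV => _; apply.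
have xi'_neq0 : dot xi' xi' != 0 by rewrite gt_eqF.
have T'E c : energy (deviation xi' nu' c) =
    T' + ComplexField.Normc.normc (zeta' - c) ^+ 2 * dot xi' xi'.
  exact: energy_deviation.
have T'_le c : T' <= energy (deviation xi' nu' c).
  by rewrite T'E lerDl mulr_ge0 ?sqr_ge0 // ltW.
have DeltaE : Delta = shift nu_perp.
  rewrite /shift /nu_perp /transverse -deviation_mulmx -!map_act.
  by rewrite dot_deviation // mulfK // (inj_eq (@complexI R)).
split.
- by split; [exists zeta' | move=> _ [c _ <-]; apply: T'_le].
- by rewrite /T'old T'E addrK.
- exact: DeltaE.
- exact: T'_le.
- by exists (dot_mulmx_div (toC xi') (map_mx intr V) (dot xi' xi')%:C).
Qed.
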